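(* Let $G$ be a finite connected graph with minimum degree $\delta(G)\geq 2$. Then either $G^2$ is maximally edge-connected, or \[ \lambda(G^2) \geq \kappa(G)\,(\delta(G)+1). \]
   Context: All graphs are finite and simple. The square $G^2$ of $G$ is the graph on $V(G)$ in which two distinct vertices are adjacent if and only if their distance in $G$ is at most $2$. $\lambda(H)$ denotes the edge-connectivity of $H$ (minimum number of edges whose removal disconnects $H$), $\kappa(G)$ the (vertex-)connectivity of $G$ (minimum number of vertices whose removal disconnects $G$), and $\delta(G)$ the minimum degree. A graph is maximally edge-connected if its edge-connectivity equals its minimum degree. *)

(* Defs.v *)
From mathcomp Require Import all_boot.
Set Implicit Arguments.
Unset Strict Implicit.
Unset Printing Implicit Defensive.

(* A finite simple graph is a symmetric irreflexive relation [e] on a finType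
   [T] of vertices. *)

(* Vacuously true when [T] is empty, so [~~ is_connected e] always means that
   two vertices are separated. *)
Definition is_connected (T : finType) (e : rel T) : bool :=
  [forall x, forall y, connect e x y].

Definition degree (T : finType) (e : rel T) (x : T) : nat :=
  #|[set y | e x y]|.

(* A degree never exceeds #|T|, so the default is irrelevant unless [T] is
   empty. *)
Definition min_degree (T : finType) (e : rel T) : nat :=
  \big[minn/#|T|]_(x : T) degree e x.

Definition edges (T : finType) (e : rel T) : {set {set T}} :=
  [set [set p.1; p.2] | p : T * T & e p.1 p.2].

Definition del_edges (T : finType) (e : rel T) (F : {set {set T}}) : rel T :=
  [rel x y | e x y && ([set x; y] \notin F)].

Definition del_vertices (T : finType) (e : rel T) (S : {set T}) :
    rel {x : T | x \in ~: S} :=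
  relpre val e.
Arguments del_vertices {T} e S.

(* If #|T| > 1, removing all the edges disconnects the graph, so the default
   is only used for a graph with at most one vertex, where it is 0. *)
Definition edge_connectivity (T : finType) (e : rel T) : nat :=
  \big[minn/#|edges e|]_(F : {set {set T}} |
      (F \subset edges e) && ~~ is_connected (del_edges e F)) #|F|.

(* A disconnecting set leaves at least two vertices, so the default is only
   used when there is none, i.e. for a complete graph: the connectivity of K_n
   is n - 1, as usual. *)
Definition connectivity (T : finType) (e : rel T) : nat :=
  \big[minn/#|T|.-1]_(S : {set T} | ~~ is_connected (del_vertices e S)) #|S|.

(* The least length of a walk from [x] to [y]; finite distances are < #|T|,
   and the value #|T|.+1 stands for infinity. It is not #|T|, which would put
   two isolated vertices forming the whole graph at distance 2. *)
Definition dist (T : finType) (e : rel T) (x y : T) : nat :=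
  \big[minn/#|T|.+1]_(k < #|T| |
      [exists p : k.-tuple T, path e x p && (last x p == y)]) k.

Definition square (T : finType) (e : rel T) : rel T :=
  [rel x y | (x != y) && (dist e x y <= 2)].

Definition maximally_edge_connected (T : finType) (e : rel T) : Prop :=
  edge_connectivity e = min_degree e.

(* Main.v *)
Require Import Defs.
From mathcomp Require Import all_boot.
From mathcomp Require Import zify.

Set Implicit Arguments.
Unset Strict Implicit.
Unset Printing Implicit Defensive.

(** Let [F] be an edge cut of [G^2] with sides [X] and [~: X], let [W v] be
    the number of edges of [F] at [v], let [q v] be the number of neighbours
    of [v] in [G] on the other side, and put [K = delta(G) + 1]. If [|F| <
    delta(G^2)], then each side contains a vertex with [W = 0]. Seen as vertex
    weights, [W] makes every path of [G] joining two such vertices on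
    different sides weigh at least [2K]: either the path crosses the cut at
    least three times, and the ends of the first and of the third crossing
    edge weigh [K] each, or it contains [x, a, b, y] with [x, a] on one side
    and [b, y] on the other, of total weight at least [2K]. The level sets of
    the weighted distance are then [2K] vertex cuts which cover each [v] at
    most [W v] times, so that [2K * kappa(G) <= \sum_v W v <= 2|F|]. An
    explicit potential takes the place of the weighted distance below, so that
    no paths are needed. *)

(** * Minima over finite types, adjacency in the square, vertex cuts *)

Lemma bigminn_leq (I : finType) (P : pred I) (f : I -> nat) d i :
  P i -> \big[minn/d]_(j | P j) f j <= f i.
Proof.
rewrite -big_filter => Pi.
have: i \in [seq j <- index_enum I | P j].
  by rewrite mem_filter Pi mem_index_enum.
elim: [seq _ <- _ | _] => // j s IHs; rewrite inE big_cons geq_min.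
by case/predU1P=> [-> | /IHs ->]; rewrite ?leqnn ?orbT.
Qed.

Arguments bigminn_leq {I P} f {d i}.

Lemma leq_bigminn (I : finType) (P : pred I) (f : I -> nat) d m :
  m <= d -> (forall i, P i -> m <= f i) -> m <= \big[minn/d]_(i | P i) f i.
Proof.
by move=> md mf; elim/big_ind: _ => // p q mp mq; rewrite leq_min mp.
Qed.

Lemma squareE (T : finType) (e : rel T) x y :
  square e x y = (x != y) && (e x y || [exists z, e x z && e z y]).
Proof.
rewrite /square /=; case: eqVneq => //= xy.
apply/idP/idP => [|near].
  apply: contraLR; rewrite -ltnNge negb_or => /andP[nexy].
  move=> /existsPn nexzy; apply: leq_bigminn => [|[k kT] /= /existsP[p]].
    (* The default [#|T|.+1] of [dist] exceeds 2 because [x] and [y] differ. *)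
    by rewrite ltnS (leq_trans _ (max_card (mem [set x; y]))) // cards2 xy.
  case/andP; case: p => -[|u [|v [|w p]]] /= /eqP <- //.
  - by rewrite (negPf xy).
  - by rewrite andbT => exu /eqP uy; rewrite -uy exu in nexy.
  - move=> /and3P[exu euv _] /eqP vy.
    by have := nexzy u; rewrite exu -vy euv.
have below (s : seq T) : path e x s -> last x s = y -> size s < #|T| ->
    size s <= 2 -> dist e x y <= 2.
  move=> xs sy sT s2; apply: leq_trans s2.
  apply: (bigminn_leq (@nat_of_ord #|T|) (i := Ordinal sT)).
  by apply/existsP; exists (in_tuple s); rewrite xs sy eqxx.
have T2 : 1 < #|T|.
  by rewrite (leq_trans _ (max_card (mem [set x; y]))) // cards2 xy.
case: (boolP (e x y)) near => [exy _ | nexy /=].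
  by apply: (below [:: y]); rewrite //= exy.
case/existsP=> z /andP[exz ezy]; apply: (below [:: z; y]) => //=.
  by rewrite exz ezy.
(* [dist] admits only lengths below [#|T|], so the walk through [z] counts only once [x], [z], [y]
   are known to be distinct. *)
have xz : x != z by apply: contraNneq nexy => ->.
have zy : z != y by apply: contraNneq nexy => <-.
apply: leq_trans (max_card (mem (y |: [set x; z]))).
by rewrite cardsU1 cards2 !inE negb_or xz eq_sym xy eq_sym zy.
Qed.

Lemma square_sym (T : finType) (e : rel T) :
  symmetric e -> symmetric (square e).
Proof.
move=> e_sym x y; rewrite !squareE eq_sym e_sym; congr (_ && (_ || _)).
by apply: eq_existsb => z; rewrite andbC (e_sym x) (e_sym z).
Qed.

(** A walk from [x] avoiding [S] can never leave [A]: its first vertex outside [A] would lie in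
    [S]. *)
Lemma connectivity_leq (T : finType) (e : rel T) (A S : {set T}) x y :
    x \in A -> x \notin S -> y \notin A -> y \notin S ->
    (forall u v, e u v -> u \in A -> v \notin A -> v \in S) ->
  connectivity e <= #|S|.
Proof.
move=> xA xS yA yS A_S; apply: (bigminn_leq (fun S : {set T} => #|S|)).
rewrite -in_setC in xS; rewrite -in_setC in yS.
apply/negP=> /forallP/(_ (Sub x xS))/forallP/(_ (Sub y yS))/connectP[p].
move: xA; rewrite -[x in x \in A]/(val (Sub x xS : {x : T | x \in ~: S})).
elim: p (Sub x xS) => [|v p IHp] u uA /=.
  by move=> _ E; rewrite -E in uA; rewrite uA in yA.
case/andP=> euv vp ylast; apply: (IHp v) => //.
apply: contraT => vA; have := A_S _ _ euv uA vA.
by have := valP v; rewrite /= inE => /negPf->.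
Qed.

Lemma sum_interval_leq m a w : \sum_(t < m) (a <= t < a + w) <= w.
Proof.
have -> : \sum_(t < m) (a <= t < a + w) = minn m (a + w) - a.
  by elim: m => [|m IHm]; rewrite ?big_ord0 ?big_ord_recr /= ?IHm; lia.
lia.
Qed.

(** * Degrees across a cut *)

Section Cut.

Variables (T : finType) (X : {set T}).

Definition crossing (h : rel T) : rel T :=
  [rel u v | h u v && ((u \in X) != (v \in X))].

Definition staying (h : rel T) : rel T :=
  [rel u v | h u v && ((u \in X) == (v \in X))].

Lemma degree_split h v :
  degree h v = degree (staying h) v + degree (crossing h) v.
Proof.
rewrite /degree -(cardsID [set u | (v \in X) == (u \in X)] [set u | h v u]).
by congr (_ + _); apply: eq_card => u;
  rewrite !inE /staying /crossing /= 1?andbC.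
Qed.

(** A crossing edge has exactly one end on each side, so it is counted once in each sum. *)
Lemma sum_crossing_degree (h : rel T) (F : {set {set T}}) :
    (forall u v, crossing h u v -> [set u; v] \in F) ->
  \sum_(v in X) degree (crossing h) v <= #|F| /\
  \sum_(v in ~: X) degree (crossing h) v <= #|F|.
Proof.
move=> hF.
have bound (Y : {set T}) : Y = X \/ Y = ~: X ->
    \sum_(v in Y) degree (crossing h) v <= #|F|.
  move=> YX.
  have YE u v : crossing h u v -> u \in Y -> v \notin Y.
    case/andP=> _; case: YX => ->; rewrite ?inE //.
      by move=> nuv uX; rewrite uX in nuv; case: (v \in X) nuv.
    by case: (u \in X) (v \in X) => [] [].
  pose P := [set p : T * T | (p.1 \in Y) && crossing h p.1 p.2].
  have -> : \sum_(v in Y) degree (crossing h) v = #|P|.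
    rewrite -sum1dep_card.
    rewrite -(pair_big_dep (fun u => u \in Y) (crossing h) (fun _ _ => 1)) /=.
    by apply: eq_bigr => v _; rewrite sum1dep_card.
  rewrite -(card_in_imset (f := fun p : T * T => [set p.1; p.2])).
    apply/subset_leq_card/subsetP => _ /imsetP[p + ->].
    by rewrite inE => /andP[_ /hF].
  move=> [u v] [u' v']; rewrite !inE => /andP[/= uY cuv] /andP[/= uY' cuv'] E.
  have vY := YE _ _ cuv uY; have vY' := YE _ _ cuv' uY'.
  have: u \in [set u'; v'] by rewrite -E !inE eqxx.
  have: v \in [set u'; v'] by rewrite -E !inE eqxx orbT.
  rewrite !inE => /orP[] /eqP Ev /orP[] /eqP Eu; subst => //.
  - by rewrite uY' in vY.
  - by rewrite uY' in vY.
  - by rewrite uY in vY'.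
by split; apply: bound; [left | right].
Qed.

(** Otherwise [x] contributes its own crossing degree and every other vertex of [Y] at least 1,
    which pays for the neighbours of [x] inside [Y]; the sum then reaches [degree h x]. *)
Lemma crossing_degree_eq0 (h : rel T) (Y : {set T}) x :
    Y = X \/ Y = ~: X -> x \in Y -> irreflexive h ->
    \sum_(v in Y) degree (crossing h) v < min_degree h ->
  exists2 v, v \in Y & degree (crossing h) v = 0.
Proof.
move=> YX xY h_irr ltW.
have [/exists_inP[v vY /eqP W0] | ] :=
  boolP [exists v in Y, degree (crossing h) v == 0].
  by exists v.
rewrite negb_exists_in => /forall_inP Wpos.
suff: min_degree h <= \sum_(v in Y) degree (crossing h) v by rewrite leqNgt ltW.
have le_deg : min_degree h <= degree h x by apply: (bigminn_leq (degree h)).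
apply: leq_trans le_deg _.
rewrite degree_split addnC (big_setD1 x) //= leq_add2l.
apply: (@leq_trans #|Y :\ x|).
  apply/subset_leq_card/subsetP => u; rewrite !inE => /andP[hxu].
  have -> : u != x by apply: contraTneq hxu => ->; rewrite h_irr.
  by case: YX xY => ->; rewrite ?inE; case: (x \in X); case: (u \in X).
rewrite -sum1_card; apply: leq_sum => v; rewrite inE => /andP[_ vY].
by rewrite lt0n Wpos.
Qed.

Variable e : rel T.
Hypotheses (e_sym : symmetric e) (e_irr : irreflexive e).

Let W := degree (crossing (square e)).
Let q := degree (crossing e).

Lemma crossing_square u v z :
    (u \in X) != (z \in X) -> e u v -> e v z -> crossing (square e) u z.
Proof.
move=> uz euv evz; rewrite /crossing /= uz andbT squareE.
rewrite (contra_neq _ uz) => [|-> //].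
by apply/orP; right; apply/existsP; exists v; rewrite euv.
Qed.

Lemma crossing_in_square u z : crossing e u z -> crossing (square e) u z.
Proof.
case/andP=> euz uz; rewrite /crossing /= uz andbT squareE euz andbT.
by apply: contraTneq euz => ->; rewrite e_irr.
Qed.

Lemma crossing_degree_leq_square v : q v <= W v.
Proof.
apply/subset_leq_card/subsetP => z; rewrite !inE; exact: crossing_in_square.
Qed.

Lemma crossing_degree_leq_neighbour u v : staying e u v -> q v <= W u.
Proof.
case/andP=> euv uv; apply/subset_leq_card/subsetP => z; rewrite !inE.
case/andP=> evz vz; apply: crossing_square euv evz.
by rewrite (eqP uv).
Qed.

(** In the square, [u] is joined across the cut to [v] and to all neighbours of [v] on the side of
    [v]. *)
Lemma staying_degree_lt_neighbour u v :
  crossing e u v -> degree (staying e) v < W u.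
Proof.
move=> cuv; have [euv uv] := andP cuv.
have: #|v |: [set z | staying e v z]| <= W u.
  apply/subset_leq_card/subsetP => z; rewrite !inE.
  case/predU1P=> [-> | /andP[evz vz]]; first exact: crossing_in_square.
  by apply: crossing_square euv evz; rewrite -(eqP vz).
by rewrite cardsU1 inE /staying /= e_irr.
Qed.

Lemma crossing_sym u v : crossing e u v = crossing e v u.
Proof. by rewrite /crossing /= e_sym eq_sym. Qed.

(** * The potential and its level sets *)

Let K := (min_degree e).+1.

(* A lower bound for the weight of a path from a vertex of [X] of weight 0 to
   [v], the weight of [v] itself excluded. *)
Definition potential v :=
  if v \in X then minn (q v) K else K.*2 - (W v + minn (q v) K).

Lemma potential_edge u v : e u v -> potential v <= potential u + W u.
Proof.
move=> euv; rewrite /potential.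
have qW := crossing_degree_leq_square.
have dge w : K <= (degree (staying e) w + q w).+1.
  by rewrite ltnS -degree_split; apply: (bigminn_leq (degree e)).
case: (boolP ((u \in X) == (v \in X))) => uv.
  have st: staying e u v by rewrite /staying /= euv.
  have st' : staying e v u by rewrite /staying /= e_sym eq_sym euv.
  move: (qW u) (qW v) (crossing_degree_leq_neighbour st)
    (crossing_degree_leq_neighbour st').
  rewrite (eqP uv); case: (v \in X); lia.
(* Here [W u + q v] and [W v + q u] are both at least [K], which settles the crossing out of [X].
   For the crossing back into [X] the caps at [K] suffice:
   [potential v <= K <= potential u + W u]. *)
have cr : crossing e u v by rewrite /crossing /= euv.
have cr' : crossing e v u by rewrite crossing_sym.
move: (qW u) (qW v) (staying_degree_lt_neighbour cr)
  (staying_degree_lt_neighbour cr') (dge u) (dge v).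
by move: uv; case: (u \in X); case: (v \in X) => // _; lia.
Qed.

Lemma connectivity_leq_sum_crossing_degree x y :
    x \in X -> y \notin X -> W x = 0 -> W y = 0 ->
  connectivity e * K.*2 <= \sum_v W v.
Proof.
move=> xX yX Wx Wy.
pose C (t : 'I_K.*2) := [set v | potential v <= t < potential v + W v].
have qx : q x = 0 by have := crossing_degree_leq_square x; lia.
have qy : q y = 0 by have := crossing_degree_leq_square y; lia.
have prex : potential x = 0 by rewrite /potential xX qx min0n.
have prey : potential y = K.*2.
  by rewrite /potential (negPf yX) qy Wy min0n subn0.
(* Having weight 0, [x] and [y] lie in no level set. An edge leaving the set of vertices finished by
   time [t] leads to a vertex of potential at most [t], hence into [C t]. *)
have cut t : connectivity e <= #|C t|.
  apply: (connectivity_leq (A := [set v | potential v + W v <= t])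
    (x := x) (y := y)).
  - by rewrite inE prex Wx.
  - by rewrite inE prex Wx; lia.
  - by rewrite inE prey -ltnNge Wy; have := ltn_ord t; lia.
  - by rewrite inE prey Wy; lia.
  - by move=> u v /potential_edge euv; rewrite !inE; lia.
have: \sum_(t < K.*2) connectivity e <= \sum_(t < K.*2) #|C t|.
  by apply: leq_sum => t _.
rewrite sum_nat_const card_ord mulnC => /leq_trans; apply.
rewrite (eq_bigr (fun t => \sum_v (v \in C t : nat))); last first.
  move=> t _; rewrite -sum1_card big_mkcond.
  by apply: eq_bigr => v _; case: ifP.
rewrite exchange_big; apply: leq_sum => v _ /=.
under eq_bigr do rewrite inE.
exact: sum_interval_leq.
Qed.

End Cut.

(** * From a single cut to the edge-connectivity *)

Lemma min_leq_cut (T : finType) (e : rel T) (X : {set T})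
    (F : {set {set T}}) x y :
    symmetric e -> irreflexive e -> x \in X -> y \notin X ->
    (forall u v, crossing X (square e) u v -> [set u; v] \in F) ->
  minn (min_degree (square e)) (connectivity e * (min_degree e).+1) <= #|F|.
Proof.
move=> e_sym e_irr xX yX /sum_crossing_degree[WX WY].
rewrite geq_min; case: leqP => //= ltF.
have sq_irr : irreflexive (square e) by move=> v; rewrite squareE eqxx.
have [x0 x0X Wx0] := crossing_degree_eq0 (or_introl erefl) xX sq_irr
  (leq_ltn_trans WX ltF).
have yCX : y \in ~: X by rewrite inE.
have [y0 + Wy0] := crossing_degree_eq0 (or_intror erefl) yCX sq_irr
  (leq_ltn_trans WY ltF).
rewrite inE => y0X.
have := connectivity_leq_sum_crossing_degree e_sym e_irr x0X y0X Wx0 Wy0.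
(* Each side weighs at most [#|F|], which cancels the factor 2 of [K.*2]. *)
rewrite -doubleMr (bigID (mem X)) /= => le_sum.
rewrite -leq_double (leq_trans le_sum) // -addnn leq_add //.
apply: leq_trans WY.
by rewrite (eq_bigl (fun v => v \in ~: X)) // => v; rewrite inE.
Qed.

Lemma edge_connectivity_leq_min_degree (T : finType) (h : rel T) :
  1 < #|T| -> edge_connectivity h <= min_degree h.
Proof.
move=> T2.
have le_deg v : edge_connectivity h <= degree h v.
  have [w wv] : exists w, w != v.
    apply/existsP; rewrite -negb_forall; apply: contraL T2 => /forallP all_v.
    rewrite -leqNgt -(card1 v) subset_leq_card //; apply/subsetP => w _.
    exact: all_v.
  (* Deleting all edges at [v] isolates it from [w]. *)
  pose F := [set [set v; u] | u in [set u | h v u]].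
  apply: (@leq_trans #|F|); last exact: leq_imset_card.
  apply: (bigminn_leq (fun F : {set {set T}} => #|F|)); apply/andP; split.
    apply/subsetP => _ /imsetP[u + ->]; rewrite inE => hvu.
    by apply/imsetP; exists (v, u); rewrite ?inE.
  apply/negP => /forallP/(_ v)/forallP/(_ w)/connectP[[|u p]] /=.
    by move=> _ E; rewrite E eqxx in wv.
  case/andP => /andP[hvu /imsetP[]].
  by exists u; rewrite ?inE.
apply: leq_bigminn => //.
have [v _] : exists v, v \in T by apply/card_gt0P; exact: ltnW.
exact: leq_trans (le_deg v) (max_card _).
Qed.

Theorem theorem3 (T : finType) (e : rel T)
    (e_sym : symmetric e) (e_irr : irreflexive e)
    (e_conn : is_connected e) (e_deg : 2 <= min_degree e) :
  maximally_edge_connected (square e) \/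
  connectivity e * (min_degree e).+1 <= edge_connectivity (square e).
Proof.
have T2 : 1 < #|T|.
  apply: leq_trans e_deg _; rewrite /min_degree.
  by elim/big_ind: _ => // [m n le_m _|v _]; rewrite ?geq_min ?le_m ?max_card.
have le_ec := edge_connectivity_leq_min_degree (square e) T2.
have [|lt_ec] := leqP (connectivity e * (min_degree e).+1)
  (edge_connectivity (square e)); first by right.
left; apply/eqP; rewrite /maximally_edge_connected eqn_leq le_ec /=.
suff: minn (min_degree (square e)) (connectivity e * (min_degree e).+1)
    <= edge_connectivity (square e).
  by rewrite geq_min [X in _ || X]leqNgt lt_ec orbF.
apply: leq_bigminn => [|F /andP[_ /forallPn[x /forallPn[y nxy]]]].
  (* The default value of the minimum, the number of all edges, is bounded through the cut around a
     single vertex. *)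
  have [x [y [_ _ xy]]] : exists x y, [/\ x \in T, y \in T & x != y].
    by apply/card_gt1P.
  apply: (min_leq_cut (X := [set x]) (x := x) (y := y)) => //.
  - by rewrite inE.
  - by rewrite inE eq_sym.
  - move=> u v /andP[huv _].
    by apply/imsetP; exists (u, v); rewrite ?inE.
(* The side [X] is the component of [x] once [F] is deleted, so every edge leaving it belongs to
   [F]. *)
apply: (min_leq_cut (X := [set z | connect (del_edges (square e) F) x z])
  (x := x) (y := y)) => //; rewrite ?inE //.
move=> u v /andP[huv]; rewrite !inE; apply: contraNT => nF.
have del_sym : symmetric (del_edges (square e) F).
  by move=> a b; rewrite /del_edges /= (square_sym e_sym) setUC.
have uv : del_edges (square e) F u v by rewrite /del_edges /= huv.
by rewrite (same_connect_r (sym_connect_sym del_sym) (connect1 uv)).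
Qed.
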